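(* For any two finite pseudo-metric spaces $(X,d_X)$ and $(Y,d_Y)$, $$d^E_{\mathrm{CatMet}}(X,Y)=2\,d_{\mathrm{GH}}(X,Y).$$
   Context: A finite pseudo-metric space $(X,d_X)$ is a non-empty finite set $X$ with a symmetric function $d_X:X\times X\to[0,\infty)$ satisfying the triangle inequality and $d_X(a,a)=0$. **CatMet.** Objects: finite pseudo-metric spaces. Morphisms $(X,d_X)\to(Y,d_Y)$: surjective functions $f:X\to Y$ such that $d_X(x_1,x_2)\ge d_X(x_3,x_4)$ implies $d_Y(f(x_1),f(x_2))\ge d_Y(f(x_3),f(x_4))$ for all $x_1,\dots,x_4\in X$. Cost of $f$: $\max_{x_1,x_2\in X}|d_X(x_1,x_2)-d_Y(f(x_1),f(x_2))|$. **Edit distance.** A path between objects $A,B$ is a finite sequence of morphisms $A\leftrightarrow D_1\leftrightarrow\cdots\leftrightarrow D_{k-1}\leftrightarrow B$ of the category, each $\leftrightarrow$ being a morphism in either direction; the cost of the path is the sum of the costs of its morphisms. The edit distance $d^E_{\mathrm{CatMet}}(A,B)$ is the infimum of the costs of all paths between $A$ and $B$ (with $\inf\emptyset=+\infty$). **Gromov-Hausdorff distance.** A tripod between $X$ and $Y$ is a set $Z$ with surjections $\phi_X:Z\to X$, $\phi_Y:Z\to Y$; its distortion is $\max_{z_1,z_2\in Z}|d_X(\phi_X(z_1),\phi_X(z_2))-d_Y(\phi_Y(z_1),\phi_Y(z_2))|$. Then $d_{\mathrm{GH}}(X,Y)$ is $\tfrac12$ times the infimum of the distortions of all tripods between $X$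 and $Y$. *)

(* Defs.v *)
From mathcomp Require Import all_boot all_order all_algebra.
From mathcomp Require Import boolp classical_sets functions reals ereal.

Set Implicit Arguments.
Unset Strict Implicit.
Unset Printing Implicit Defensive.
Import Order.TTheory GRing.Theory Num.Theory.
Local Open Scope classical_set_scope.
Local Open Scope ring_scope.

Record finPseudoMetric (R : realType) : Type := FinPseudoMetric {
  point :> finType;
  dist : point -> point -> R;
  point_card_gt0 : (0 < #|point|)%N;
  dist_ge0 : forall a b, 0 <= dist a b;
  distC : forall a b, dist a b = dist b a;
  dist_triangle : forall a b c, dist a c <= dist a b + dist b c;
  distxx : forall a, dist a a = 0 }.

Record catMetHom (R : realType) (X Y : finPseudoMetric R) : Type := CatMetHom {
  hom_fun :> X -> Y;
  hom_surj : set_surj [set: X] [set: Y] hom_fun;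
  hom_mono : forall x1 x2 x3 x4 : X, dist x3 x4 <= dist x1 x2 ->
    dist (hom_fun x3) (hom_fun x4) <= dist (hom_fun x1) (hom_fun x2) }.

(* The default value 0 of the iterated maximum is harmless: the range is
   nonempty and every term is nonnegative. *)
Definition catMetCost (R : realType) (X Y : finPseudoMetric R)
    (f : catMetHom X Y) : R :=
  \big[Num.max/0]_(x1 : X) \big[Num.max/0]_(x2 : X)
    `|dist x1 x2 - dist (f x1) (f x2)|.

(* A zigzag consists of at least one arrow; each arrow is given together with
   its direction. *)
Inductive zigzag (Ob : Type) (Hom : Ob -> Ob -> Type) : Ob -> Ob -> Type :=
| ZigzagOne (A B : Ob) : Hom A B + Hom B A -> zigzag Hom A B
| ZigzagCons (A D B : Ob) :
    Hom A D + Hom D A -> zigzag Hom D B -> zigzag Hom A B.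

Definition arrow_cost (R : realType) (Ob : Type) (Hom : Ob -> Ob -> Type)
    (cost : forall A B, Hom A B -> R) (A B : Ob) (s : Hom A B + Hom B A) : R :=
  match s with inl f => cost A B f | inr g => cost B A g end.

Fixpoint zigzag_cost (R : realType) (Ob : Type) (Hom : Ob -> Ob -> Type)
    (cost : forall A B, Hom A B -> R) (A B : Ob) (p : zigzag Hom A B) : R :=
  match p with
  | ZigzagOne _ _ s => arrow_cost cost s
  | ZigzagCons _ _ _ s q => arrow_cost cost s + zigzag_cost cost q
  end.

(* Not stated with [range], whose index type must live in a universe too small
   for the zigzags between finite pseudo-metric spaces. *)
Definition edit_distance (R : realType) (Ob : Type) (Hom : Ob -> Ob -> Type)
    (cost : forall A B, Hom A B -> R) (A B : Ob) : \bar R :=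
  ereal_inf [set c | exists p : zigzag Hom A B, c = (zigzag_cost cost p)%:E].

Definition catMet_edit_distance (R : realType) (X Y : finPseudoMetric R) :
    \bar R :=
  edit_distance (@catMetCost R) X Y.

Record tripod (R : realType) (X Y : finPseudoMetric R) : Type := Tripod {
  apex :> Type;
  legl : apex -> X;
  legr : apex -> Y;
  legl_surj : set_surj [set: apex] [set: X] legl;
  legr_surj : set_surj [set: apex] [set: Y] legr }.

(* The apex may be infinite, but the set below is finite (as X and Y are) and
   nonempty, so that its supremum is a maximum. *)
Definition distortion (R : realType) (X Y : finPseudoMetric R)
    (Z : tripod X Y) : R :=
  sup [set `|dist (legl z1) (legl z2) - dist (legr z1) (legr z2)|
      | z1 in [set: Z] & z2 in [set: Z]].

Definition GH_distance (R : realType) (X Y : finPseudoMetric R) : \bar R :=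
  ((2^-1)%:E *
   ereal_inf [set e | exists Z : tripod X Y, e = (distortion Z)%:E])%E.

(* Main.v *)
Require Import Defs.
From mathcomp Require Import all_boot all_order all_algebra.
From mathcomp Require Import boolp classical_sets functions reals ereal.
From mathcomp Require Import ring lra.

(** Both inequalities compare zigzags of morphisms with tripods.

    A single morphism [f] is a tripod with apex its source, whose distortion is
    the cost of [f]; fibre products compose tripods and at worst add up their
    distortions.  So a zigzag of cost [c] yields a tripod of distortion at most
    [c] ([zigzag_tripod]).

    Conversely, replace the apex of a tripod by its image [T] in [X * Y], which
    is finite, and pull both distances back to [T], giving [d0] and [d1] with
    [|d0 - d1| <= c].  The projections from [T] are morphisms of cost zero, so
    it remains to join [(T, d0)] to [(T, d1)] at cost at most [c]
    ([zigzag_same_points]).  This is done by travelling along the segment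
    [(1 - t) d0 + t d1], on which the costs of identity maps are proportional to
    the time elapsed and thus add up to at most [c].  The identity is a morphism
    only where it preserves the weak order of the distances.  Say that
    two pairs of points cross if [d0] and [d1] order them in strictly opposite
    ways.  Without crossings, the midpoint [(d0 + d1) / 2] has morphisms to both
    ends, since the order it puts on pairs refines the order of each end.  If
    two pairs cross, stop at the time [t] when their distances agree: a crossing
    on either half is a crossing on the whole segment, and the chosen one
    disappears from both halves, so induction on the number of crossings
    concludes. *)

Set Implicit Arguments.
Unset Strict Implicit.
Unset Printing Implicit Defensive.
Import Order.TTheory GRing.Theory Num.Theory.
Local Open Scope classical_set_scope.
Local Open Scope ring_scope.

(** * Costs of morphisms and zigzags *)

Section Zigzags.
Variable R : realType.
Implicit Types X Y Z : finPseudoMetric R.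

Lemma catMetCost_ge X Y (f : catMetHom X Y) x1 x2 :
  `|dist x1 x2 - dist (f x1) (f x2)| <= catMetCost f.
Proof.
by apply: (le_trans _ (le_bigmax _ _ x1)); apply: (le_trans _ (le_bigmax _ _ x2)).
Qed.

Lemma catMetCost_le X Y (f : catMetHom X Y) c : 0 <= c ->
  (forall x1 x2, `|dist x1 x2 - dist (f x1) (f x2)| <= c) -> catMetCost f <= c.
Proof. by move=> c0 fc; do 2 (apply: bigmax_le => // ? _). Qed.

Definition zigzag_within X Y (c : R) :=
  exists p : zigzag (@catMetHom R) X Y, zigzag_cost (@catMetCost R) p <= c.

Lemma zigzag_within_hom X Y (f : catMetHom X Y) :
  zigzag_within X Y (catMetCost f).
Proof. by exists (ZigzagOne (inl f)). Qed.

Lemma zigzag_within_homV X Y (f : catMetHom Y X) :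
  zigzag_within X Y (catMetCost f).
Proof. by exists (ZigzagOne (inr f)). Qed.

Lemma zigzag_within_le X Y c c' : c <= c' ->
  zigzag_within X Y c -> zigzag_within X Y c'.
Proof. by move=> cc' [p pc]; exists p; apply: le_trans cc'. Qed.

Lemma zigzag_within_trans X Y Z c c' :
  zigzag_within X Y c -> zigzag_within Y Z c' -> zigzag_within X Z (c + c').
Proof.
case=> p pc [q qc].
suff [r rE] : exists r : zigzag (@catMetHom R) X Z,
    zigzag_cost (@catMetCost R) r
    = zigzag_cost (@catMetCost R) p + zigzag_cost (@catMetCost R) q.
  by exists r; rewrite rE lerD.
elim: p q {pc qc} => [A B s|A D B s p IHp] q.
  by exists (ZigzagCons s q).
by have [r rE] := IHp q; exists (ZigzagCons s r); rewrite /= rE addrA.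
Qed.

End Zigzags.

Arguments zigzag_within {R} X Y c.

Lemma id_surj (A : Type) : set_surj [set: A] [set: A] id.
Proof. by move=> x _; exists x. Qed.

(** * Zigzags between two distances on the same points *)

Section SamePoints.
Variables (R : realType) (T : finType) (T_gt0 : (0 < #|T|)%N).

(** The laws of [finPseudoMetric], as a predicate: interpolating distances
    requires the set of points to stay literally the same. *)
Record pseudometric (d : T -> T -> R) : Prop := Pseudometric {
  pseudometric_ge0 : forall a b, 0 <= d a b;
  pseudometricC : forall a b, d a b = d b a;
  pseudometric_triangle : forall a b c, d a c <= d a b + d b c;
  pseudometricxx : forall a, d a a = 0 }.

Definition metric_on d (dP : pseudometric d) : finPseudoMetric R :=
  FinPseudoMetric T_gt0 (pseudometric_ge0 dP) (pseudometricC dP)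
    (pseudometric_triangle dP) (pseudometricxx dP).

Definition mix (t : R) (d d' : T -> T -> R) a b := (1 - t) * d a b + t * d' a b.

Lemma mix_pseudometric t d d' : 0 <= t <= 1 ->
  pseudometric d -> pseudometric d' -> pseudometric (mix t d d').
Proof.
move=> /andP[t0 t1] dP d'P; have s0 : 0 <= 1 - t by rewrite subr_ge0.
split=> [a b|a b|a b c|a]; rewrite /mix.
- by rewrite addr_ge0 ?mulr_ge0 ?(pseudometric_ge0 dP) ?(pseudometric_ge0 d'P).
- by rewrite (pseudometricC dP) (pseudometricC d'P).
- rewrite addrACA -!mulrDr lerD // ler_wpM2l //.
  + exact: (pseudometric_triangle dP).
  + exact: (pseudometric_triangle d'P).
- by rewrite (pseudometricxx dP) (pseudometricxx d'P) !mulr0 addr0.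
Qed.

Lemma mix_distl t d d' a b : 0 <= t ->
  `|d a b - mix t d d' a b| = t * `|d a b - d' a b|.
Proof.
by move=> t0; rewrite -{2}(ger0_norm t0) -normrM /mix; congr (`|_|); ring.
Qed.

Lemma mix_distr t d d' a b : t <= 1 ->
  `|mix t d d' a b - d' a b| = (1 - t) * `|d a b - d' a b|.
Proof.
move=> t1; have s0 : 0 <= 1 - t by rewrite subr_ge0.
by rewrite -(ger0_norm s0) -normrM /mix; congr (`|_|); ring.
Qed.

Section IdentityHom.
Variables (d d' : T -> T -> R) (dP : pseudometric d) (d'P : pseudometric d').
Hypothesis dd' : forall a b a' b', d a b <= d a' b' -> d' a b <= d' a' b'.

Definition id_hom : catMetHom (metric_on dP) (metric_on d'P) :=
  @CatMetHom R (metric_on dP) (metric_on d'P) id (@id_surj T)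
    (fun a' b' a b => @dd' a b a' b').

Lemma id_hom_cost_le c : 0 <= c -> (forall a b, `|d a b - d' a b| <= c) ->
  catMetCost id_hom <= c.
Proof. by move=> c0 dc; apply: catMetCost_le. Qed.

End IdentityHom.

(** A crossing is oriented, so each pair of oppositely ordered pairs of points
    gives one element of this set. *)
Definition crossings (d d' : T -> T -> R) : {set (T * T) * (T * T)} :=
  [set pq | (d pq.1.1 pq.1.2 < d pq.2.1 pq.2.2)
         && (d' pq.2.1 pq.2.2 < d' pq.1.1 pq.1.2)]%SET.

(** The midpoint refines the order of both ends: a sum of two numbers that are
    not of opposite signs is nonnegative only if both of them are. *)
Lemma zigzag_no_crossing d d' (dP : pseudometric d) (d'P : pseudometric d')
    (c : R) :
  0 <= c -> crossings d d' = finset.set0 ->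
  (forall a b, `|d a b - d' a b| <= c) ->
  zigzag_within (metric_on dP) (metric_on d'P) c.
Proof.
move=> c0 /setP no_crossing dd'c.
have half01 : 0 <= (2^-1 : R) <= 1 by lra.
have uncrossed a b a' b' : d a b < d a' b' -> d' a b <= d' a' b'.
  move=> dlt; have := no_crossing ((a, b), (a', b')).
  by rewrite !inE /= dlt /= => /negbT; rewrite -leNgt.
have mP := mix_pseudometric half01 dP d'P; set m := mix _ _ _ in mP.
have md a b a' b' : m a b <= m a' b' -> d a b <= d a' b'.
  rewrite /m /mix => mle; case: leP => // dlt.
  by have := uncrossed _ _ _ _ dlt; lra.
have md' a b a' b' : m a b <= m a' b' -> d' a b <= d' a' b'.
  rewrite /m /mix => mle; case: leP => // d'lt.
  case: (ltP (d a b) (d a' b')) => [/uncrossed|]; lra.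
have c2 : 0 <= c / 2 by lra.
have -> : c = c / 2 + c / 2 by field.
apply: (@zigzag_within_trans _ _ (metric_on mP)).
- apply: zigzag_within_le (zigzag_within_homV (id_hom mP dP md)).
  apply: id_hom_cost_le => // a b.
  by rewrite distrC mix_distl; have := dd'c a b; lra.
- apply: zigzag_within_le (zigzag_within_hom (id_hom mP d'P md')).
  by apply: id_hom_cost_le => // a b; rewrite mix_distr; have := dd'c a b; lra.
Qed.

(** Along the segment the difference of two distances is affine, so once it has
    strictly changed sign it cannot come back. *)
Lemma crossings_mixl t d d' : 0 <= t <= 1 ->
  crossings d (mix t d d') \subset crossings d d'.
Proof.
move=> /andP[t0 t1]; apply/fintype.subsetP => -[[a b] [a' b']].
rewrite !inE /mix /= => /andP[dlt mlt]; rewrite dlt /=.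
by rewrite ltNge; apply/negP => d'le; nra.
Qed.

Lemma crossings_mixr t d d' : 0 <= t <= 1 ->
  crossings (mix t d d') d' \subset crossings d d'.
Proof.
move=> /andP[t0 t1]; apply/fintype.subsetP => -[[a b] [a' b']].
rewrite !inE /mix /= => /andP[mlt d'lt]; rewrite d'lt andbT.
by rewrite ltNge; apply/negP => dle; nra.
Qed.

(** The two distances of a chosen crossing are equal at [mix t d d'], so it is a
    crossing of neither half of the segment, and the induction applies to both.
    The budget [c] splits as [t * c] and [(1 - t) * c]. *)
Lemma zigzag_same_points d d' (dP : pseudometric d) (d'P : pseudometric d')
    (c : R) :
  0 <= c -> (forall a b, `|d a b - d' a b| <= c) ->
  zigzag_within (metric_on dP) (metric_on d'P) c.
Proof.
have [n] := ubnP #|crossings d d'|.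
elim: n => // n IHn in d d' dP d'P c *; rewrite ltnS => size_le c0 dd'c.
have [nc|/finset.set0Pn[[[a b] [a' b']] pq_crosses]] :=
  eqVneq (crossings d d') finset.set0.
  exact: zigzag_no_crossing.
have := pq_crosses; rewrite inE /= => /andP[dlt d'lt].
(* The zero of the affine function [t |-> mix t (a', b') - mix t (a, b)],
   which equals [u > 0] at time 0 and [- v < 0] at time 1. *)
pose u := d a' b' - d a b; pose v := d' a b - d' a' b'.
have u0 : 0 < u by rewrite subr_gt0.
have v0 : 0 < v by rewrite subr_gt0.
pose t := u / (u + v).
have uv0 : 0 < u + v by rewrite addr_gt0.
have t0 : 0 <= t by rewrite divr_ge0 ?ltW.
have t1 : t <= 1 by rewrite ler_pdivrMr // mul1r lerDl ltW.
have t01 : 0 <= t <= 1 by rewrite t0.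
have tie : mix t d d' a b = mix t d d' a' b'.
  apply/eqP; rewrite -subr_eq0; apply/eqP.
  transitivity (t * (u + v) - u); first by rewrite /mix /u /v; ring.
  by rewrite /t divfK ?subrr // gt_eqF.
have mP := mix_pseudometric t01 dP d'P.
have s0 : 0 <= 1 - t by rewrite subr_ge0.
have -> : c = t * c + (1 - t) * c by ring.
apply: (@zigzag_within_trans _ _ (metric_on mP)); apply: IHn.
- apply: leq_trans size_le; apply/proper_card/properP.
  split; first exact: crossings_mixl.
  by exists ((a, b), (a', b')); rewrite // inE /= tie ltxx andbF.
- by rewrite mulr_ge0.
- by move=> x y; rewrite mix_distl // ler_wpM2l.
- apply: leq_trans size_le; apply/proper_card/properP.
  split; first exact: crossings_mixr.
  by exists ((a, b), (a', b')); rewrite // inE /= tie ltxx.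
- by rewrite mulr_ge0.
- by move=> x y; rewrite mix_distr // ler_wpM2l.
Qed.

End SamePoints.

(** * From tripods to zigzags *)

Section Pullback.
Variables (R : realType) (X : finPseudoMetric R) (T : finType).
Variables (T_gt0 : (0 < #|T|)%N) (f : T -> X).

Definition pullback_dist a b := dist (f a) (f b).

Lemma pullback_pseudometric : pseudometric pullback_dist.
Proof.
split=> *; rewrite /pullback_dist; [exact: dist_ge0 | exact: distC |
  exact: dist_triangle | exact: distxx].
Qed.

Definition pullback := metric_on T_gt0 pullback_pseudometric.

Hypothesis f_surj : set_surj [set: T] [set: X] f.

Definition pullback_hom : catMetHom pullback X :=
  @CatMetHom R pullback X f f_surj (fun _ _ _ _ => id).

Lemma pullback_hom_cost_le0 : catMetCost pullback_hom <= 0.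
Proof. by apply: catMetCost_le => // x1 x2; rewrite subrr normr0. Qed.

End Pullback.

Section Tripods.
Variable R : realType.
Implicit Types X Y W : finPseudoMetric R.

Definition gap X Y (Z : tripod X Y) (z1 z2 : Z) :=
  `|dist (legl z1) (legl z2) - dist (legr z1) (legr z2)|.

Lemma legl_onto X Y (Z : tripod X Y) x : exists z : Z, legl z = x.
Proof. by have [z] := @legl_surj _ _ _ Z x I; exists z. Qed.

Lemma legr_onto X Y (Z : tripod X Y) y : exists z : Z, legr z = y.
Proof. by have [z] := @legr_surj _ _ _ Z y I; exists z. Qed.

Lemma tripod_inhabited X Y (Z : tripod X Y) : exists z : Z, True.
Proof.
have /card_gt0P[x _] := point_card_gt0 X.
by have [z _] := legl_onto Z x; exists z.
Qed.

(** The supremum is attained within the finite set of quadruples of points, so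
    it bounds the gaps even when the apex is infinite. *)
Lemma gap_le_distortion X Y (Z : tripod X Y) (z1 z2 : Z) :
  gap z1 z2 <= distortion Z.
Proof.
apply: ub_le_sup; last by exists z1 => //; exists z2.
exists (\big[Num.max/0]_(q : (X * X) * (Y * Y))
          `|dist q.1.1 q.1.2 - dist q.2.1 q.2.2|).
move=> _ [w1 _ [w2 _ <-]].
exact: (le_bigmax _ (fun q : (X * X) * (Y * Y) =>
  `|dist q.1.1 q.1.2 - dist q.2.1 q.2.2|)
  ((legl w1, legl w2), (legr w1, legr w2))).
Qed.

Lemma distortion_le X Y (Z : tripod X Y) c :
  (forall z1 z2 : Z, gap z1 z2 <= c) -> distortion Z <= c.
Proof.
move=> gap_c; apply: ge_sup => [|_ [z1 _ [z2 _ <-]]]; last exact: gap_c.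
have [z _] := tripod_inhabited Z.
by exists (gap z z), z => //; exists z.
Qed.

Lemma tripod_zigzag X Y (Z : tripod X Y) : zigzag_within X Y (distortion Z).
Proof.
pose T := {xy : X * Y | `[< exists z : Z, (legl z, legr z) = xy >]}.
pose image_point (z : Z) : T :=
  exist _ (legl z, legr z) (asboolT (ex_intro _ z erefl)).
have [z0 _] := tripod_inhabited Z.
have T_gt0 : (0 < #|{: T}|)%N.
  by apply/card_gt0P; exists (image_point z0).
pose p (w : T) : X := (val w).1; pose q (w : T) : Y := (val w).2.
have p_surj : set_surj [set: T] [set: X] p.
  by move=> x _; have [z <-] := legl_onto Z x; exists (image_point z).
have q_surj : set_surj [set: T] [set: Y] q.
  by move=> y _; have [z <-] := legr_onto Z y; exists (image_point z).
have gap_T (w1 w2 : T) :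
    `|pullback_dist p w1 w2 - pullback_dist q w1 w2| <= distortion Z.
  have /asboolP[z1 E1] := valP w1; have /asboolP[z2 E2] := valP w2.
  by rewrite /pullback_dist /p /q -E1 -E2; apply: gap_le_distortion.
have -> : distortion Z = 0 + (distortion Z + 0) by rewrite addr0 add0r.
apply: (@zigzag_within_trans _ _ (pullback T_gt0 p)).
  apply: zigzag_within_le (pullback_hom_cost_le0 T_gt0 p_surj) _.
  exact: zigzag_within_homV.
apply: (@zigzag_within_trans _ _ (pullback T_gt0 q)).
  apply: zigzag_same_points => //.
  exact: le_trans (normr_ge0 _) (gap_le_distortion z0 z0).
apply: zigzag_within_le (pullback_hom_cost_le0 T_gt0 q_surj) _.
exact: zigzag_within_hom.
Qed.

(** * From zigzags to tripods *)

Definition hom_tripod X Y (f : catMetHom X Y) : tripod X Y :=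
  Tripod (@id_surj X) (@hom_surj _ _ _ f).

Definition tripod_flip X Y (Z : tripod X Y) : tripod Y X :=
  Tripod (@legr_surj _ _ _ Z) (@legl_surj _ _ _ Z).

Section FibreProduct.
Variables (X Y W : finPseudoMetric R) (Z : tripod X Y) (Z' : tripod Y W).

Definition fibre_product := {zz : Z * Z' | legr zz.1 = legl zz.2}.

Lemma fibre_product_surjl : set_surj [set: fibre_product] [set: X]
  (fun zz => legl (sval zz).1).
Proof.
move=> x _; have [z <-] := legl_onto Z x.
have [z' E] := legl_onto Z' (legr z).
by exists (exist _ (z, z') (esym E)).
Qed.

Lemma fibre_product_surjr : set_surj [set: fibre_product] [set: W]
  (fun zz => legr (sval zz).2).
Proof.
move=> w _; have [z' <-] := legr_onto Z' w.
have [z E] := legr_onto Z (legl z').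
by exists (exist _ (z, z') E).
Qed.

Definition tripod_comp : tripod X W :=
  Tripod fibre_product_surjl fibre_product_surjr.

Lemma distortion_comp : distortion tripod_comp <= distortion Z + distortion Z'.
Proof.
apply: distortion_le => -[[z1 z1'] E1] [[z2 z2'] E2]; rewrite /gap /=.
apply: le_trans (ler_distD (dist (legr z1) (legr z2)) _ _) _.
rewrite lerD ?gap_le_distortion //=; rewrite /= in E1 E2.
by rewrite E1 E2 gap_le_distortion.
Qed.

End FibreProduct.

Lemma arrow_tripod X Y (s : catMetHom X Y + catMetHom Y X) :
  exists Z : tripod X Y, distortion Z <= arrow_cost (@catMetCost R) s.
Proof.
case: s => f /=.
- by exists (hom_tripod f); apply: distortion_le => x1 x2; apply: catMetCost_ge.
- exists (tripod_flip (hom_tripod f)); apply: distortion_le => y1 y2.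
  by rewrite /gap distrC; apply: (catMetCost_ge f y1 y2).
Qed.

Lemma zigzag_tripod X Y (p : zigzag (@catMetHom R) X Y) :
  exists Z : tripod X Y, distortion Z <= zigzag_cost (@catMetCost R) p.
Proof.
elim: p => [A B s|A D B s p [Z' Z'le]] /=; first exact: arrow_tripod.
have [Z Zle] := arrow_tripod s; exists (tripod_comp Z Z').
exact: le_trans (distortion_comp _ _) (lerD Zle Z'le).
Qed.

End Tripods.

(** * The edit distance *)

Theorem proposition3p1p5 (R : realType) (X Y : finPseudoMetric R) :
  catMet_edit_distance X Y = (2%:E * GH_distance X Y)%E.
Proof.
rewrite /GH_distance muleA -EFinM divff ?mul1e; last by rewrite pnatr_eq0.
apply/eqP; rewrite eq_le; apply/andP; split.
- apply: le_ereal_inf_tmp => _ [Z ->]; have [p pZ] := tripod_zigzag Z.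
  apply: le_trans (ereal_inf_lbound _) (_ : ((zigzag_cost _ p)%:E <= _)%E).
    by exists p.
  by rewrite lee_fin.
- apply: le_ereal_inf_tmp => _ [p ->]; have [Z Zp] := zigzag_tripod p.
  apply: le_trans (ereal_inf_lbound _) (_ : ((distortion Z)%:E <= _)%E).
    by exists Z.
  by rewrite lee_fin.
Qed.
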